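(* Let $\ell$ be a positive integer. For any non-negative integer $n$, $$v(\Pi_n)=\left(\prod_{i=2}^n\left(c_i^{i-1}\prod_{j=1}^{\lfloor(i-1)/\ell\rfloor}b_{0,-j}\right)\right)\left(\prod_{s=1}^{n}\prod_{t=0}^{s-1}\sum_{i=0}^\ell b_{i,t}c_{s}^{\ell-i}\right).$$
   Context: A path is a finite word over a finite set of steps (integer vectors) together with an initial point in $\mathbb{Z}^2$; it goes from its initial point to its final point. An $\ell$-Schröder path is a path in the $x$-$y$ plane with steps $\mathsf{a}_i=(i,\ell-i)$ for $i=0,\ldots,\ell$ and $\mathsf{a}_{\ell+1}=(1,-1)$, never going below the $x$-axis. Let $b_{i,j}$ ($0\le i\le\ell$, $j\in\mathbb{Z}$) and $c_j$ ($j\in\mathbb{Z}$) be indeterminates. The weight $v$ of the step $\mathsf{a}_i$ ($0\le i\le \ell$) starting at $(x,y)$ is $b_{i,j}$, and the weight of $\mathsf{a}_{\ell+1}$ starting at $(x,y)$ is $c_j$, where $j=(x+y)/\ell$ (an integer for all the paths considered). The weight $v(\omega)$ of a path $\omega$ is the product of the weights of its steps. A path system of size $n$ from $\mathbf{s}=(s_0,\ldots,s_{n-1})$ to $\mathbf{t}=(t_0,\ldots,t_{n-1})$ (tuples of points of $\mathbb{Z}^2$) is a tuple $\boldsymbol{\omega}=(\omega_0,\ldots,\omega_{n-1})$ of paths such that $\omega_i$ goes from $s_i$ to $t_{\sigma(i)}$ for all $i$, for some permutation $\sigma$ of $\{0,\ldots,n-1\}$. It is non-intersecting if the paths are pairwise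 disjoint, i.e. no steps of two different paths share a starting or ending point (the drawn line segments may cross). Its weight is $v(\boldsymbol{\omega})=\operatorname{sign}(\sigma)\,v(\omega_0)\cdots v(\omega_{n-1})$. $\Pi_n$ is the set of non-intersecting path systems of $n$ $\ell$-Schröder paths from $\mathbf{s}=((-i,\,i\bmod\ell))_{i=0,\ldots,n-1}$ to $\mathbf{t}=(((i+1)\ell,0))_{i=0,\ldots,n-1}$, where $i\bmod \ell$ is the remainder of dividing $i$ by $\ell$. Put $v(\Pi_n)=\sum_{\boldsymbol{\omega}\in\Pi_n}v(\boldsymbol{\omega})$ (with $v(\Pi_0)=1$). *)

(* Defs.v *)
From HB Require Import structures.
From mathcomp Require Import all_boot all_order all_fingroup all_algebra.
From mathcomp Require Import boolp classical_sets functions cardinality fsbigop.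

Set Implicit Arguments.
Unset Strict Implicit.
Unset Printing Implicit Defensive.

Import Order.TTheory GRing.Theory Num.Theory.
Local Open Scope classical_set_scope.
Local Open Scope ring_scope.

Definition point : Type := (int * int)%type.

(* [Some i] is the step a_i = (i, l - i) for 0 <= i <= l and [None] is the
   step a_(l+1) = (1, -1).  These l + 2 vectors are pairwise distinct, so words
   over [step l] are the same as words over the set of vectors. *)
Definition step (l : nat) : Type := option 'I_l.+1.

Definition step_vec (l : nat) (s : step l) : point :=
  if s is Some i then (i%:Z, l%:Z - i%:Z) else (1, -1).

(* A path is its initial point together with its word of steps. *)
Definition lpath (l : nat) : Type := (point * seq (step l))%type.

HB.instance Definition _ := Choice.on point.
HB.instance Definition _ := GRing.Zmodule.on point.
HB.instance Definition _ (l : nat) := Finite.on (step l).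
HB.instance Definition _ (l : nat) := Choice.on (lpath l).

Definition path_vertices (l : nat) (p : lpath l) : seq point :=
  p.1 :: scanl (fun P s => P + step_vec s) p.1 p.2.

Definition path_final (l : nat) (p : lpath l) : point :=
  last p.1 (path_vertices p).

Definition goes_from_to (l : nat) (p : lpath l) (P Q : point) : Prop :=
  p.1 = P /\ path_final p = Q.

(* The drawn path is a union of segments between consecutive vertices, so it
   stays weakly above the x-axis if and only if its vertices do. *)
Definition schroder (l : nat) (p : lpath l) : Prop :=
  forall P : point, P \in path_vertices p -> 0 <= P.2.

Section Weights.
Variables (R : comNzRingType) (l : nat).
Variables (b : 'I_l.+1 -> int -> R) (c : int -> R).

(* The indeterminates b_(i,j) and c_j are arbitrary elements of an arbitrary
   commutative ring.  The quotient by l is exact at every vertex of the paths in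
   [Pi l n] below: l divides x + y at the initial points, and every step changes
   x + y by l or by 0. *)
Definition step_weight (P : point) (s : step l) : R :=
  let j := ((P.1 + P.2) %/ l%:Z)%Z in
  if s is Some i then b i j else c j.

Fixpoint word_weight (P : point) (w : seq (step l)) : R :=
  if w is s :: w' then step_weight P s * word_weight (P + step_vec s) w' else 1.

Definition path_weight (p : lpath l) : R := word_weight p.1 p.2.

End Weights.

Definition connects (l n : nat) (S T : 'I_n -> point)
    (w : {ffun 'I_n -> lpath l}) (sigma : 'S_n) : Prop :=
  forall i, goes_from_to (w i) (S i) (T (sigma i)).

Definition path_system (l n : nat) (S T : 'I_n -> point)
    (w : {ffun 'I_n -> lpath l}) : Prop :=
  exists sigma : 'S_n, connects S T w sigma.

Definition nonintersecting (l n : nat) (w : {ffun 'I_n -> lpath l}) : Prop :=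
  forall i j : 'I_n, i != j ->
  forall P : point, P \in path_vertices (w i) -> P \notin path_vertices (w j).

(* The permutation is recovered from the tuple of paths; it is unique as soon
   as the final points are pairwise distinct (see [connects_inj]). *)
Definition system_weight (R : comNzRingType) (l n : nat)
    (b : 'I_l.+1 -> int -> R) (c : int -> R) (S T : 'I_n -> point)
    (w : {ffun 'I_n -> lpath l}) : R :=
  if [pick sigma : 'S_n | `[< connects S T w sigma >]] is Some sigma
  then (-1) ^+ sigma * \prod_(i < n) path_weight b c (w i) else 0.

Definition start_pt (l n : nat) (i : 'I_n) : point := (- i%:Z, (i %% l)%N%:Z).

Definition end_pt (l n : nat) (i : 'I_n) : point := ((i.+1 * l)%N%:Z, 0).

Definition Pi (l n : nat) : set {ffun 'I_n -> lpath l} :=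
  [set w | [/\ path_system (@start_pt l n) (@end_pt l n) w,
               forall i, schroder (w i) & nonintersecting w]].

Arguments Pi : clear implicits.

(* The sum over a set is the finitely supported one; [Pi l n] is finite by
   [finite_Pi]. *)
Definition v_Pi (R : comNzRingType) (l n : nat)
    (b : 'I_l.+1 -> int -> R) (c : int -> R) : R :=
  \sum_(w \in Pi l n)
     system_weight b c (@start_pt l n) (@end_pt l n) w.

Lemma connects_inj (l n : nat) (S T : 'I_n -> point)
    (w : {ffun 'I_n -> lpath l}) (sigma tau : 'S_n) :
  injective T -> connects S T w sigma -> connects S T w tau -> sigma = tau.
Proof.
move=> injT Hs Ht; apply/permP => i; apply: injT.
by case: (Hs i) => _ <-; case: (Ht i).
Qed.

Lemma end_pt_inj (l n : nat) : (0 < l)%N -> injective (@end_pt l n).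
Proof.
move=> l_gt0 i j [] /eqP; rewrite eqn_pmul2r // eqSS => /eqP ij.
exact: val_inj.
Qed.

(* 2x + y increases by at least 1 along every step. *)
Lemma size_path_le (l : nat) (p : lpath l) : (0 < l)%N ->
  (size p.2)%:Z <= (2 * (path_final p).1 + (path_final p).2)
                   - (2 * p.1.1 + p.1.2).
Proof.
move=> l_gt0; case: p => P w; rewrite /path_final /path_vertices /=.
elim: w P => [|s w IHw] P /=; first by rewrite subrr.
have := IHw (P + step_vec s).
set Q := last _ _ => leQ; rewrite -addn1 PoszD.
have step_ge1 : 1 <= 2 * (step_vec s).1 + (step_vec s).2.
  case: s {IHw Q leQ} => [i|] //=.
  by rewrite addrCA mulr_natl mulr2n addrK -PoszD lez_nat addn_gt0 l_gt0.
apply: le_trans (lerD leQ step_ge1) _.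
rewrite [(P + step_vec s).1]/= [(P + step_vec s).2]/=.
have subDK (x y z : int) : x - (y + z) + z = x - y by rewrite opprD addrA subrK.
by rewrite mulrDr [X in - X]addrACA subDK.
Qed.

Lemma finite_Pi (l n : nat) : (0 < l)%N -> finite_set (Pi l n).
Proof.
move=> l_gt0; pose B := (2 * (n * l) + 2 * n)%N.
pose W := {k : 'I_B.+1 & k.-tuple (step l)}.
pose mk (f : {ffun 'I_n -> W}) : {ffun 'I_n -> lpath l} :=
  [ffun i => (start_pt l i, val (tagged (f i)))].
apply: (@sub_finite_set _ _ (mk @` setT)); last first.
  by apply: finite_image; exact: finite_finset.
move=> w [[sigma Hw] _ _].
have szB i : (size (w i).2 < B.+1)%N.
  have [st fin] := Hw i; have := size_path_le (w i) l_gt0.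
  rewrite fin st /= addr0 => le_sz; rewrite ltnS -lez_nat.
  apply: le_trans le_sz _; rewrite mulrN opprD opprK addrA lerBlDr.
  rewrite -!PoszM -!PoszD lez_nat; apply: leq_trans (leq_addr _ _).
  apply: leq_add; rewrite leq_mul2l /=; last exact: ltnW.
  by apply: leq_mul => //; exact: ltn_ord.
exists [ffun i => Tagged (fun k : 'I_B.+1 => k.-tuple (step l))
                    (in_tuple (w i).2 : (Ordinal (szB i)).-tuple _)] => //.
apply/ffunP => i; rewrite !ffunE /=.
by have [<- _] := Hw i; case: (w i).
Qed.

(* Main.v *)
Require Import Defs.
From mathcomp Require Import all_boot all_order all_fingroup all_algebra.
From mathcomp Require Import boolp classical_sets functions cardinality fsbigop.
From mathcomp Require Import zify.

(** Since vertex-disjointness is all that is required, the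
    Lindström–Gessel–Viennot lemma turns v(Pi_n) into the determinant of the
    path sums from s_i to t_j, although the graph is not planar.  Encode the
    height y on the level x + y = l a as the monomial X^y.  Crossing from level a
    to level a + 1 is multiplication by B_a = sum_i b_(i,a) X^(l-i), and the runs
    of down steps on level a act by D_a f = (X f - c_a f(c_a)) / (X - c_a), with
    final value f(c_a) on the last level.

    D_a preserves the degree and the leading coefficient, so on level 0 the i-th
    row is a polynomial of degree i whose leading coefficient is the product of
    the b_(0,-j) with 1 <= j <= i / l.  Expanding these rows in the Newton basis
    N_k = (X - c_1) ... (X - c_k) factors the matrix as lower triangular times
    upper triangular: as D_a ((X - c_a) g) = X g, starting from N_k each of the
    first k levels trades one factor X - c_a for X, and the value at c_(j+1)
    vanishes for j < k and is c_(k+1)^k B_0(c_(k+1)) ... B_k(c_(k+1)) for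
    j = k.  No division is needed, so this works in any commutative ring. *)

Set Implicit Arguments.
Unset Strict Implicit.
Unset Printing Implicit Defensive.

Import Order.TTheory GRing.Theory Num.Theory.
Local Open Scope ring_scope.

(** * Down steps and level crossings as operators on polynomials *)

Section DownPoly.
Variable R : comNzRingType.
Implicit Types (f g : {poly R}) (x : R).

(* Encoding height y as 'X^y, [down x] sums over all runs of down steps of
   weight x: it maps 'X^y to the sum of the x ^+ m *: 'X^(y - m). *)
Definition down x f : {poly R} :=
  Pdiv.CommonRing.rdivp ('X * f) ('X - x%:P).

(** The remainder modulo the monic ['X - x%:P] is constant, and evaluation at [x] identifies it. *)
Lemma downE x f : down x f * ('X - x%:P) = 'X * f - (x * f.[x])%:P.
Proof.
rewrite [in RHS](Pdiv.RingMonic.rdivp_eq (monicXsubC x) ('X * f)) -/(down x f).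
have := Pdiv.RingMonic.rdivp_eq (monicXsubC x) ('X * f).
set r := Pdiv.CommonRing.rmodp _ _ => E.
have /size1_polyC rE : (size r <= 1)%N.
  have := Pdiv.Ring.ltn_rmodpN0 ('X * f) (monic_neq0 (monicXsubC x)).
  by rewrite size_XsubC ltnS.
have := congr1 (horner^~ x) E.
rewrite !(hornerE, hornerM) subrr mulr0 add0r rE hornerC => ->.
by rewrite addrK.
Qed.

(** A monic factor can be cancelled over any ring, so the rules below are checked after
    multiplication by ['X - x%:P]. *)
Lemma down_uniq x f g :
  g * ('X - x%:P) = 'X * f - (x * f.[x])%:P -> down x f = g.
Proof. by move=> gE; apply: (monic_rreg (monicXsubC x)); rewrite downE gE. Qed.

Lemma downD x f g : down x (f + g) = down x f + down x g.
Proof.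
apply: down_uniq; rewrite mulrDl !downE hornerD !mulrDr polyCD opprD.
by rewrite addrACA.
Qed.

Lemma downZ x a f : down x (a *: f) = a *: down x f.
Proof.
apply: down_uniq; rewrite -scalerAl downE hornerZ scalerBr scalerAr.
by rewrite [x * (a * _)]mulrCA [(a * _)%:P]polyCM mul_polyC.
Qed.

Lemma down0 x : down x 0 = 0.
Proof. by apply: down_uniq; rewrite horner0 !mulr0 mul0r subrr. Qed.

Lemma down1 x : down x 1 = 1.
Proof. by apply: down_uniq; rewrite hornerC !mulr1 mul1r. Qed.

(** A run of down steps from height [y.+1] is empty or begins with a step of weight [x]. *)
Lemma downXS x y : down x 'X^(y.+1) = 'X^(y.+1) + x *: down x 'X^y.
Proof.
apply: down_uniq; rewrite mulrDl -scalerAl downE !hornerXn -!exprS.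
rewrite -!mul_polyC !polyC_exp mulrBr mulrBr -exprSr -exprS mulrC addrA.
by rewrite subrK.
Qed.

Lemma down_factor x f : down x (('X - x%:P) * f) = 'X * f.
Proof.
apply: down_uniq; rewrite hornerM hornerXsubC subrr mul0r mulr0 subr0.
by rewrite -mulrA [f * _]mulrC.
Qed.

Lemma size_down x f : (size (down x f) <= size f)%N.
Proof.
have [->|nz] := eqVneq (down x f) 0; first by rewrite size_poly0.
have fn0 : f != 0 by apply: contraNneq nz => ->; rewrite down0.
rewrite -ltnS; have := size_Mmonic nz (monicXsubC x).
rewrite downE size_XsubC addn2 /= => <-.
apply: leq_trans (size_polyD _ _) _; rewrite geq_max mulrC size_mulX //=.
by rewrite leqnn size_polyN (leq_trans (size_polyC_leq1 _)).
Qed.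

Lemma down_top x f i : (size f <= i.+1)%N -> (down x f)`_i = f`_i.
Proof.
move=> szf; have := congr1 (fun g : {poly R} => g`_i.+1) (downE x f).
rewrite /= mulrBr !coefB coefMX coefMC coefXM coefC /= subr0.
by rewrite (nth_default 0 (leq_trans (size_down x f) szf)) mul0r subr0.
Qed.

End DownPoly.

Lemma sub_lead_size (R : nzRingType) (f g : {poly R}) i :
  (size f <= i.+1)%N -> (size g <= i.+1)%N -> g`_i = 1 ->
  (size (f - f`_i *: g)%R <= i)%N.
Proof.
move=> szf szg g1; apply/leq_sizeP => j; rewrite leq_eqVlt => /orP[/eqP<-|ij].
  by rewrite coefB coefZ g1 mulr1 subrr.
rewrite coefB coefZ (nth_default 0 (leq_trans szf ij)).
by rewrite (nth_default 0 (leq_trans szg ij)) mulr0 subrr.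
Qed.

(** * Transfer between levels, and its triangular form in the Newton basis *)

Section Transfer.
Variables (R : comNzRingType) (l : nat).
Variables (b : 'I_l.+1 -> int -> R) (c : int -> R).
Implicit Types (f g : {poly R}) (a : int).

Definition up a : {poly R} := \sum_(i < l.+1) b i a *: 'X^(l - i).

Definition push1 a f := up a * down (c a) f.

Fixpoint push a m f := if m is m'.+1 then push (a + 1) m' (push1 a f) else f.

(* The weight of all paths from level [a] to height 0 on level [a + m], the
   starting height being encoded by [f]; the last run of down steps turns
   'X^y into [c (a + m) ^+ y]. *)
Definition land a m f : R := (push a m f).[c (a + m%:Z)].

Lemma push1D a f g : push1 a (f + g) = push1 a f + push1 a g.
Proof. by rewrite /push1 downD mulrDr. Qed.

Lemma push1Z a x f : push1 a (x *: f) = x *: push1 a f.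
Proof. by rewrite /push1 downZ scalerAr. Qed.

Lemma pushD a m f g : push a m (f + g) = push a m f + push a m g.
Proof. by elim: m a f g => //= m IH a f g; rewrite push1D IH. Qed.

Lemma pushZ a m x f : push a m (x *: f) = x *: push a m f.
Proof. by elim: m a f => //= m IH a f; rewrite push1Z IH. Qed.

Lemma landD a m f g : land a m (f + g) = land a m f + land a m g.
Proof. by rewrite /land pushD hornerD. Qed.

Lemma landZ a m x f : land a m (x *: f) = x * land a m f.
Proof. by rewrite /land pushZ hornerZ. Qed.

Lemma land_sum a m (I : Type) (r : seq I) (F : I -> {poly R}) :
  land a m (\sum_(i <- r) F i) = \sum_(i <- r) land a m (F i).
Proof.
elim: r => [|i r IH]; last by rewrite !big_cons landD IH.
by rewrite !big_nil -(scale0r 0) landZ mul0r.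
Qed.

Lemma landS a m f : land a m.+1 f = land (a + 1) m (push1 a f).
Proof. by rewrite /land -addrA -[1 + _]PoszD add1n. Qed.

Lemma land_push a m m' f :
  land a (m + m') f = land (a + m%:Z) m' (push a m f).
Proof.
elim: m a f => [|m IH] a f; first by rewrite addr0.
by rewrite addSn landS IH -addrA -[1 + _]PoszD add1n.
Qed.

Lemma size_up a : (size (up a) <= l.+1)%N.
Proof.
apply: leq_trans (size_sum _ _ _) _; apply/bigmax_leqP => i _.
apply: leq_trans (size_scale_leq _ _) _.
by rewrite size_polyXn ltnS leq_subr.
Qed.

Lemma up_top a : (up a)`_l = b ord0 a.
Proof.
rewrite coef_sum (bigD1 ord0) //= coefZ coefXn subn0 eqxx mulr1.
rewrite big1 ?addr0 // => i; rewrite -val_eqE /= -lt0n => i_gt0.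
rewrite coefZ coefXn gtn_eqF ?mulr0 // ltn_subrL i_gt0.
exact: leq_trans i_gt0 (leq_ord i).
Qed.

Lemma coefM_top f g i j : (size f <= i.+1)%N -> (size g <= j.+1)%N ->
  (f * g)`_(i + j) = f`_i * g`_j.
Proof.
move=> szf szg; have lti : (i < (i + j).+1)%N by rewrite ltnS leq_addr.
rewrite coefM (bigD1 (Ordinal lti)) //= addKn big1 ?addr0 // => k.
rewrite -val_eqE /= neq_ltn => /orP[ki|ik].
  by rewrite [g`_ _]nth_default ?mulr0 // (leq_trans szg) // ltn_subRL ltn_add2r.
by rewrite nth_default ?mul0r // (leq_trans szf).
Qed.

Lemma size_push1 a f i :
  (size f <= i.+1)%N -> (size (push1 a f) <= (l + i).+1)%N.
Proof.
move=> szf; apply: leq_trans (size_polyMleq _ _) _; rewrite -ltnS.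
have := leq_add (size_up a) (leq_trans (size_down (c a) f) szf).
by rewrite addSn addnS; case: (_ + _)%N.
Qed.

Lemma size_push a m f i :
  (size f <= i.+1)%N -> (size (push a m f) <= (m * l + i).+1)%N.
Proof.
elim: m a f i => [|m IH] a f i //= /(size_push1 a) /(IH (a + 1)).
by rewrite addnA mulSn [(l + _)%N]addnC.
Qed.

(** Each level multiplies the top coefficient by that of [up], since [down] keeps it. Fixing the
    index [i] instead of the degree covers zero coefficients as well. *)
Lemma push_top a m f i : (size f <= i.+1)%N ->
  (push a m f)`_(m * l + i) = (\prod_(t < m) b ord0 (a + t%:Z)) * f`_i.
Proof.
elim: m a f i => [|m IH] a f i szf; first by rewrite big_ord0 mul1r.
rewrite mulSn [(l + _)%N]addnC -addnA /= IH ?size_push1 // big_ord_recl addr0.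
rewrite coefM_top ?size_up ?(leq_trans (size_down _ _)) // up_top down_top //.
rewrite mulrCA mulrA; congr (_ * _ * _); apply: eq_bigr => t _.
by rewrite -addrA -[1 + _]PoszD.
Qed.

Definition newton k : {poly R} := \prod_(1 <= m < k.+1) ('X - (c m%:Z)%:P).

Lemma newtonS k : newton k.+1 = newton k * ('X - (c k.+1%:Z)%:P).
Proof. by rewrite /newton big_nat_recr. Qed.

Lemma newton_monic k : newton k \is monic.
Proof. by apply: rpred_prod => i _; apply: monicXsubC. Qed.

Lemma size_newton k : size (newton k) = k.+1.
Proof.
elim: k => [|k IH]; first by rewrite /newton big_geq // size_poly1.
rewrite newtonS size_Mmonic ?monicXsubC ?size_XsubC ?IH ?addn2 //.
exact/monic_neq0/newton_monic.
Qed.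

Lemma newton_top k : (newton k)`_k = 1.
Proof. by have /monicP := newton_monic k; rewrite /lead_coef size_newton. Qed.

(** The monic [newton k] are subtracted from the top down, without division. The last coefficient
    becomes a diagonal entry in [det_land_mx]. *)
Lemma newton_expansion k f : (size f <= k.+1)%N ->
  exists2 A : nat -> R, f = \sum_(i < k.+1) A i *: newton i & A k = f`_k.
Proof.
elim: k f => [|k IH] f szf.
  exists (fun=> f`_0) => //; rewrite big_ord1 /newton big_geq // alg_polyC.
  exact: size1_polyC.
have szN : (size (newton k.+1) <= k.+2)%N by rewrite size_newton.
have [A eA _] := IH _ (sub_lead_size szf szN (newton_top _)).
exists (fun i => if i == k.+1 then f`_k.+1 else A i); last by rewrite eqxx.
rewrite big_ord_recr /= eqxx -[LHS](subrK (f`_k.+1 *: newton k.+1)) eA.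
by congr (_ + _); apply: eq_bigr => i _; rewrite ltn_eqF.
Qed.

Lemma push_newton r k : (r <= k)%N ->
  push 1 r (up 0 * newton k) =
  (\prod_(t < r.+1) up t%:Z) * 'X^r *
    \prod_(r.+1 <= m < k.+1) ('X - (c m%:Z)%:P).
Proof.
(* [push] unfolds at its first level, while the induction on [r] appends a last one. *)
have pushSr a m f : push a m.+1 f = push1 (a + m%:Z) (push a m f).
  elim: m a f => [|m IH] a f; first by rewrite addr0.
  by rewrite [LHS]IH -addrA -[1 + _]PoszD add1n.
elim: r => [|r IH] rk; first by rewrite big_ord1 mulr1.
rewrite pushSr IH 1?ltnW // -[1 + _]PoszD add1n /push1 big_ltn //.
rewrite mulrCA down_factor [in RHS]big_ord_recr /= exprS.
rewrite -!mulrA [RHS]mulrCA; congr (_ * _).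
by rewrite [RHS]mulrCA.
Qed.

Lemma horner_up a x : (up a).[x] = \sum_(i < l.+1) b i a * x ^+ (l - i).
Proof.
by rewrite horner_sum; apply: eq_bigr => i _; rewrite hornerZ hornerXn.
Qed.

Lemma land_newton_lt j k : (j < k)%N -> land 1 j (up 0 * newton k) = 0.
Proof.
move=> jk; rewrite /land push_newton 1?ltnW // big_ltn // -PoszD add1n.
by rewrite !hornerM hornerXsubC subrr mul0r mulr0.
Qed.

Lemma land_newton_diag k : land 1 k (up 0 * newton k) =
  c k.+1%:Z ^+ k *
  \prod_(t < k.+1) \sum_(i < l.+1) b i t%:Z * c k.+1%:Z ^+ (l - i).
Proof.
rewrite /land push_newton // [X in _ * X]big_geq // mulr1 -PoszD add1n.
rewrite hornerM hornerXn horner_prod mulrC; congr (_ * _).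
by apply: eq_bigr => t _; rewrite horner_up.
Qed.

(** The [i]-th start lies on level [- (i %/ l)] at height [i %% l], and the [j]-th end on level
    [j.+1], so [i %/ l + j.+1] levels are crossed. *)
Definition land_mx n : 'M[R]_n :=
  \matrix_(i, j) land (- (i %/ l)%N%:Z) (i %/ l + j.+1)%N 'X^(i %% l).

Lemma det_land_mx n : \det (land_mx n) =
  \prod_(i < n) (\prod_(t < i %/ l) b ord0 (- (i %/ l)%N%:Z + t%:Z)) *
  \prod_(k < n) land 1 k (up 0 * newton k).
Proof.
(* Row [i] after the down runs on level 0, before the crossing to level 1. *)
pose f i := down (c 0) (push (- (i %/ l)%N%:Z) (i %/ l) 'X^(i %% l)).
have sz1 i : (size ('X^(i %% l) : {poly R}) <= (i %% l).+1)%N.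
  by rewrite size_polyXn.
have szp i : (size (push (- (i %/ l)%N%:Z) (i %/ l) 'X^(i %% l)) <= i.+1)%N.
  by have := size_push (- (i %/ l)%N%:Z) (i %/ l) (sz1 i); rewrite -divn_eq.
have szf i : (size (f i) <= i.+1)%N := leq_trans (size_down _ _) (szp i).
have topf i : (f i)`_i = \prod_(t < i %/ l) b ord0 (- (i %/ l)%N%:Z + t%:Z).
  have := push_top (- (i %/ l)%N%:Z) (i %/ l) (sz1 i).
  by rewrite coefXn eqxx mulr1 -divn_eq -(down_top (c 0) (szp i)).
have /choice[A eA] i : exists A : nat -> R,
    f i = \sum_(k < i.+1) A k *: newton k /\ A i = (f i)`_i.
  by have [A] := newton_expansion (szf i); exists A.
pose L : 'M[R]_n := \matrix_(i, k) (if (k <= i)%N then A i k else 0).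
pose U : 'M[R]_n := \matrix_(k, j) land 1 j (up 0 * newton k).
have -> : land_mx n = L *m U.
  (* The crossings split into the [i %/ l] leading to level 0, the one to level 1, and the remaining
     [j]. *)
  apply/matrixP => i j; rewrite !mxE land_push addNr landS add0r /push1 -/(f i).
  have [-> _] := eA i; rewrite mulr_sumr land_sum.
  rewrite (big_ord_widen_cond n xpredT
    (fun k => land 1 j (up 0 * (A i k *: newton k)))) //=.
  rewrite big_mkcond; apply: eq_bigr => k _; rewrite !mxE ltnS.
  by case: ifP; rewrite ?mul0r // -scalerAr landZ.
rewrite det_mulmx det_trig; last first.
  by apply/is_trig_mxP => i j ij; rewrite mxE leqNgt ij.
rewrite -[\det U]det_tr det_trig; last first.
  by apply/is_trig_mxP => i j ij; rewrite !mxE land_newton_lt.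
congr (_ * _); apply: eq_bigr => i _; rewrite !mxE ?leqnn //.
by have [_ ->] := eA i; rewrite topf.
Qed.

End Transfer.

(** * The Lindström–Gessel–Viennot lemma *)

Section Splice.
Variable l : nat.
Implicit Types (P V : Defs.point) (w u : seq (step l)).

Definition verts P w : seq Defs.point := path_vertices ((P, w) : lpath l).

Lemma size_verts P w : size (verts P w) = (size w).+1.
Proof. by rewrite /verts /path_vertices /= size_scanl. Qed.

Lemma verts_cons P s w : verts P (s :: w) = P :: verts (P + step_vec s) w.
Proof. by []. Qed.

Lemma path_final_last P w : path_final ((P, w) : lpath l) = last P (verts P w).
Proof. by []. Qed.

Lemma path_final_cons P s w :
  path_final ((P, s :: w) : lpath l) = path_final ((P + step_vec s, w) : lpath l).
Proof. by []. Qed.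

Lemma drop_verts P w k : (k <= size w)%N ->
  drop k (verts P w) = verts (nth 0 (verts P w) k) (drop k w).
Proof. by elim: w P k => [|s w IH] P [|k] //= kw; rewrite IH. Qed.

Lemma verts_take_cat P w u k : (k <= size w)%N ->
  verts P (take k w ++ u) = take k (verts P w) ++ verts (nth 0 (verts P w) k) u.
Proof. by elim: w P k => [|s w IH] P [|k] //= kw; rewrite verts_cons IH. Qed.

Lemma verts_uniq P w : (0 < l)%N -> uniq (verts P w).
Proof.
move=> l_gt0; pose h (V : Defs.point) := 2 * V.1 + V.2.
apply: (@sorted_uniq _ (fun V V' => h V < h V')).
- by move=> V1 V2 V3; apply: lt_trans.
- by move=> V; apply: ltxx.
elim: w P => //= s w IH P; apply/andP; split; last exact: IH.
have := size_path_le ((P, [:: s]) : lpath l) l_gt0.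
by rewrite lerBrDr -/(h _) -/(h _); apply: lt_le_trans; rewrite ltrDr.
Qed.

Section Weight.
Variables (R : comNzRingType) (b : 'I_l.+1 -> int -> R) (c : int -> R).

Lemma word_weight_take_cat P w u k : (k <= size w)%N ->
  word_weight b c P (take k w ++ u) =
  word_weight b c P (take k w) * word_weight b c (nth 0 (verts P w) k) u.
Proof.
elim: w P k => [|s w IH] P [|k] //= kw; rewrite ?mul1r //.
by rewrite IH // mulrA.
Qed.

End Weight.

(* Follow [w] from [P] until it first meets [V], then continue with the end of
   [w'] after its first visit of [V].  A word that misses [V] is kept whole as a
   head and is empty as a tail, so splicing it with itself, or with another word
   that misses [V], has no effect. *)
Definition splice V P w P' w' :=
  take (index V (verts P w)) w ++ drop (index V (verts P' w')) w'.

Section SpliceTheory.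
Variables (V P P' : Defs.point) (w w' : seq (step l)).
Hypothesis memV : (V \in verts P w) = (V \in verts P' w').
Let k := index V (verts P w).
Let k' := index V (verts P' w').

Lemma splice_verts :
  verts P (splice V P w P' w') = take k (verts P w) ++ drop k' (verts P' w').
Proof.
rewrite /splice -/k -/k'; case: (boolP (V \in verts P w)) => Vw.
  have Vw' : V \in verts P' w' by rewrite -memV.
  have kw : (k <= size w)%N by rewrite -ltnS -(size_verts P) index_mem.
  have kw' : (k' <= size w')%N by rewrite -ltnS -(size_verts P') index_mem.
  by rewrite verts_take_cat // drop_verts // !nth_index.
have Vw' : V \notin verts P' w' by rewrite -memV.
rewrite /k /k' !memNindex // !size_verts take_oversize // drop_oversize //.
by rewrite cats0 -(size_verts P w) take_size -(size_verts P' w') drop_size cats0.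
Qed.

Lemma splice_mem : (V \in verts P (splice V P w P' w')) = (V \in verts P w).
Proof.
rewrite splice_verts mem_cat; case: (boolP (V \in verts P w)) => Vw.
  by rewrite drop_index -?memV // inE eqxx orbT.
apply/negbTE; rewrite negb_or (contra (@mem_take _ _ _ _)) //.
by rewrite (contra (@mem_drop _ _ _ _)) // -memV.
Qed.

Lemma splice_index : index V (verts P (splice V P w P' w')) = k.
Proof.
case: (boolP (V \in verts P w)) => Vw; last first.
  have Vw' : V \notin verts P' w' by rewrite -memV.
  rewrite splice_verts /k /k' (memNindex Vw) (memNindex Vw').
  by rewrite take_size drop_size cats0 memNindex.
rewrite splice_verts index_cat in_take // ltnn drop_index -?memV //= eqxx addn0.
by rewrite size_take index_mem Vw.
Qed.

Lemma splice_weight (R : comNzRingType) (b : 'I_l.+1 -> int -> R) (c : int -> R) :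
  word_weight b c P (splice V P w P' w') =
  word_weight b c P (take k w) * word_weight b c V (drop k' w').
Proof.
rewrite /splice -/k -/k'; case: (boolP (V \in verts P w)) => Vw.
  have kw : (k <= size w)%N by rewrite -ltnS -(size_verts P) index_mem.
  by rewrite word_weight_take_cat // nth_index.
have Vw' : V \notin verts P' w' by rewrite -memV.
by rewrite /k' memNindex // size_verts drop_oversize // cats0 mulr1.
Qed.

Lemma splice_final : V \in verts P w ->
  path_final ((P, splice V P w P' w') : lpath l) =
  path_final ((P', w') : lpath l).
Proof.
move=> Vw; have Vw' : V \in verts P' w' by rewrite -memV.
rewrite !path_final_last splice_verts.
rewrite -[in RHS](cat_take_drop k' (verts P' w')) !last_cat.
by rewrite drop_index.
Qed.

End SpliceTheory.

Lemma splice_id V P w : splice V P w P w = w.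
Proof. exact: cat_take_drop. Qed.

(** By [splice_index] the second exchange cuts both words at the same places as the first. *)
Lemma spliceK V P w P' w' : (V \in verts P w) = (V \in verts P' w') ->
  splice V P (splice V P w P' w') P' (splice V P' w' P w) = w.
Proof.
move=> memV; rewrite {1}/splice !splice_index // /splice.
set k := index V (verts P w); set k' := index V (verts P' w').
case: (boolP (V \in verts P w)) => Vw.
  have kw : (k <= size w)%N by rewrite -ltnS -(size_verts P) index_mem.
  have kw' : (k' <= size w')%N.
    by rewrite -ltnS -(size_verts P') index_mem -memV.
  rewrite take_size_cat ?size_takel // drop_size_cat ?size_takel //.
  exact: cat_take_drop.
have Vw' : V \notin verts P' w' by rewrite -memV.
rewrite /k /k' !memNindex // !size_verts [drop _ w']drop_oversize //.
rewrite [drop _ w]drop_oversize // !cats0 [drop _ _]drop_oversize.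
  by rewrite cats0 take_oversize take_oversize.
by rewrite size_take; case: ifP => // _.
Qed.

End Splice.

(** * Exchange of tails at a common vertex *)

Section Crossing.
Variables (l n : nat) (S T : 'I_n -> Defs.point).
Implicit Types (u : 'I_n -> seq (step l)) (V : Defs.point) (s : 'S_n).

Definition thru u V : pred 'I_n := fun k => V \in verts (S k) (u k).

(* The set of points lying on two paths, and then the set of paths through the
   chosen point, are unchanged when tails are exchanged at that point.  As [xget]
   and [pick] depend only on these sets, the exchange is an involution. *)
Definition crossing_pt u : Defs.point := xget 0 (fun V => (1 < #|thru u V|)%N).

Definition crossing u : bool := (1 < #|thru u (crossing_pt u)|)%N.

Definition crossing_perm u : 'S_n :=
  if [pick p : 'I_n * 'I_n | [&& p.1 != p.2, thru u (crossing_pt u) p.1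
                                & thru u (crossing_pt u) p.2]]
  is Some p then tperm p.1 p.2 else 1%g.

Definition swap u k :=
  splice (crossing_pt u) (S k) (u k)
    (S (crossing_perm u k)) (u (crossing_perm u k)).

Lemma crossingP u V : (1 < #|thru u V|)%N -> crossing u.
Proof.
by move=> uV; apply: (xgetPex 0 (P := fun V => (1 < #|thru u V|)%N)); exists V.
Qed.

Lemma crossing_permK u : involutive (crossing_perm u).
Proof.
rewrite /crossing_perm; case: pickP => [p _|_] k; first exact: tpermK.
by rewrite !perm1.
Qed.

Lemma crossing_perm_odd u : crossing u -> odd_perm (crossing_perm u).
Proof.
move=> /card_gt1P[i [j [ui uj ij]]]; rewrite /crossing_perm.
case: pickP => [p /and3P[p12 _ _]|/(_ (i, j))]; first by rewrite odd_tperm.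
by rewrite /= ij (ui : thru u _ i) (uj : thru u _ j).
Qed.

Lemma thru_crossing_perm u k :
  thru u (crossing_pt u) (crossing_perm u k) = thru u (crossing_pt u) k.
Proof.
rewrite /crossing_perm; case: pickP => [p /and3P[_ p1 p2]|_].
  by case: tpermP => [->|->|//]; rewrite ?p1 ?p2.
by rewrite perm1.
Qed.

Lemma crossing_perm_moved u k :
  crossing_perm u k != k -> thru u (crossing_pt u) k.
Proof.
rewrite /crossing_perm; case: pickP => [p /and3P[_ p1 p2]|_].
  by case: tpermP => [->|->|] //; rewrite eqxx.
by rewrite perm1 eqxx.
Qed.

Lemma thru_swap u : thru (swap u) (crossing_pt u) =1 thru u (crossing_pt u).
Proof.
move=> k; apply: splice_mem.
by rewrite -/(thru _ _ _) -thru_crossing_perm.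
Qed.

(** No vertex repeats on a path, so membership is a multiplicity, and multiplicities add up over
    heads and tails. *)
Lemma card_thru u V : (0 < l)%N ->
  #|thru u V| = (\sum_k count_mem V (verts (S k) (u k)))%N.
Proof.
move=> l_gt0; rewrite -sum1_card big_mkcond; apply: eq_bigr => k _.
by rewrite (count_uniq_mem _ (verts_uniq _ _ l_gt0)); case: (thru u V k).
Qed.

(** An exchange only permutes the tails among the paths, so the multiset of all vertices is
    preserved. *)
Lemma card_thru_swap u V : (0 < l)%N -> #|thru (swap u) V| = #|thru u V|.
Proof.
move=> l_gt0; rewrite !card_thru //.
pose idx k := index (crossing_pt u) (verts (S k) (u k)).
transitivity (\sum_k count_mem V (take (idx k) (verts (S k) (u k)))
   + \sum_k count_mem V (drop (idx k) (verts (S k) (u k))))%N.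
  rewrite [X in (_ + X)%N](reindex_inj (@perm_inj _ (crossing_perm u))) /=.
  rewrite -big_split; apply: eq_bigr => k _ /=.
  rewrite -count_cat -splice_verts //.
  by rewrite -!/(thru _ _ _) thru_crossing_perm.
rewrite -big_split; apply: eq_bigr => k _ /=.
by rewrite -count_cat cat_take_drop.
Qed.

Lemma crossing_pt_swap u : (0 < l)%N -> crossing_pt (swap u) = crossing_pt u.
Proof.
move=> l_gt0; rewrite /crossing_pt; congr (xget _ _).
by apply/funext => V; rewrite card_thru_swap.
Qed.

Lemma crossing_perm_swap u :
  (0 < l)%N -> crossing_perm (swap u) = crossing_perm u.
Proof.
move=> l_gt0; rewrite /crossing_perm; congr (if _ is Some p then _ else _).
by apply: eq_pick => p; rewrite crossing_pt_swap // !thru_swap.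
Qed.

Lemma swapK u : (0 < l)%N -> swap (swap u) = u.
Proof.
move=> l_gt0; apply/funext => k; rewrite {1}/swap crossing_pt_swap //.
rewrite crossing_perm_swap // /swap crossing_permK spliceK //.
by rewrite -!/(thru _ _ _) thru_crossing_perm.
Qed.

Lemma crossing_swap u : (0 < l)%N -> crossing (swap u) = crossing u.
Proof. by move=> l_gt0; rewrite /crossing crossing_pt_swap // card_thru_swap. Qed.

(** Every nonempty tail starts at [crossing_pt u], so its weight does not depend on the head it
    follows. *)
Lemma swap_weight (R : comNzRingType) (b : 'I_l.+1 -> int -> R) (c : int -> R) u :
  \prod_k word_weight b c (S k) (swap u k) = \prod_k word_weight b c (S k) (u k).
Proof.
pose V := crossing_pt u; pose idx k := index V (verts (S k) (u k)).
transitivity (\prod_k word_weight b c (S k) (take (idx k) (u k)) *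
              \prod_k word_weight b c V (drop (idx k) (u k))).
  rewrite [X in _ * X](reindex_inj (@perm_inj _ (crossing_perm u))) /=.
  rewrite -big_split; apply: eq_bigr => k _ /=; rewrite -splice_weight //.
  by rewrite -!/(thru _ _ _) thru_crossing_perm.
rewrite -big_split; apply: eq_bigr => k _ /=.
by rewrite -splice_weight // splice_id.
Qed.

Definition lands_at (Q : Defs.point) (p : lpath l) : bool :=
  (path_final p == Q) && all (fun V : Defs.point => 0 <= V.2) (path_vertices p).

Definition connected s u := [forall k, lands_at (T (s k)) (S k, u k)].

(** Path [k] now ends where path [crossing_perm u k] ended; in a product of permutations the left
    factor acts first. *)
Lemma connected_swap s u :
  connected s u -> connected (crossing_perm u * s)%g (swap u).
Proof.
move=> /forallP su; apply/forallP => k; rewrite permM /swap.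
have [->|kk'] := eqVneq (crossing_perm u k) k; first by rewrite splice_id.
have Vk := crossing_perm_moved kk'.
have memV : thru u (crossing_pt u) k = thru u (crossing_pt u) (crossing_perm u k).
  by rewrite thru_crossing_perm.
have /andP[/eqP fk /allP ak] := su (crossing_perm u k).
have /andP[_ /allP ak0] := su k.
apply/andP; split; first by rewrite splice_final // fk.
rewrite -/(verts _ _) splice_verts // all_cat; apply/andP; split.
  by apply/allP => V /mem_take /ak0.
by apply/allP => V /mem_drop /ak.
Qed.

End Crossing.

(** * Cancellation of the crossing systems and the determinant formula *)

Section LGV.
Variables (R : comNzRingType) (l n B : nat).
Variables (b : 'I_l.+1 -> int -> R) (c : int -> R) (S T : 'I_n -> Defs.point).
Hypothesis l_gt0 : (0 < l)%N.
Hypothesis B_large : forall i j,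
  2 * (T j).1 + (T j).2 - (2 * (S i).1 + (S i).2) <= B%:Z.

Local Notation words := {ffun 'I_n -> B.-bseq (step l)}.
Implicit Types (s : 'S_n) (ws : words).

Definition word_of ws (k : 'I_n) : seq (step l) := ws k.

Lemma word_of_inj : injective word_of.
Proof.
move=> ws ws' E; apply/ffunP => k; apply: val_inj.
exact: (congr1 (fun f => f k) E).
Qed.

Definition signed_weight (p : 'S_n * words) : R :=
  (-1) ^+ p.1 * \prod_k word_weight b c (S k) (p.2 k).

Definition flip (p : 'S_n * words) : 'S_n * words :=
  ((crossing_perm S (word_of p.2) * p.1)%g,
   [ffun k => insub_bseq B (swap S (word_of p.2) k)]).

Definition crossing_system (p : 'S_n * words) :=
  connected S T p.1 (word_of p.2) && crossing S (word_of p.2).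

(** Since [2x + y] grows by at least 1 per step, [B_large] bounds the length. Hence [insub_bseq]
    never falls back on its default when [flip] acts on a crossing system. *)
Lemma size_connected s (u : 'I_n -> seq (step l)) k :
  connected S T s u -> (size (u k) <= B)%N.
Proof.
move=> /forallP/(_ k)/andP[/eqP fk _].
have := size_path_le ((S k, u k) : lpath l) l_gt0.
by rewrite fk => /le_trans/(_ (B_large k (s k))).
Qed.

Lemma word_of_flip p : crossing_system p ->
  word_of (flip p).2 = swap S (word_of p.2).
Proof.
move=> /andP[/connected_swap ok _]; apply/funext => k.
by rewrite /word_of ffunE /insub_bseq insubdK //; apply: size_connected ok.
Qed.

Lemma crossing_system_flip p : crossing_system p -> crossing_system (flip p).
Proof.
move=> pc; rewrite /crossing_system word_of_flip // crossing_swap //.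
by case/andP: pc => /connected_swap-> ->.
Qed.

Lemma flipK p : crossing_system p -> flip (flip p) = p.
Proof.
move=> pc; have pc' := crossing_system_flip pc.
case: p => s ws in pc pc' *; congr (_, _).
  rewrite word_of_flip // crossing_perm_swap // mulgA.
  suff -> : (crossing_perm S (word_of ws) * crossing_perm S (word_of ws) = 1)%g.
    by rewrite mul1g.
  by apply/permP => k; rewrite permM perm1 crossing_permK.
apply: word_of_inj; rewrite -[LHS]/(word_of (flip (flip (s, ws))).2).
by rewrite word_of_flip // word_of_flip // swapK.
Qed.

Lemma odd_flip p : crossing_system p -> odd_perm (flip p).1 = ~~ odd_perm p.1.
Proof.
by move=> /andP[_ pc]; rewrite odd_permM crossing_perm_odd.
Qed.

Lemma signed_weight_flip p :
  crossing_system p -> signed_weight (flip p) = - signed_weight p.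
Proof.
move=> pc; rewrite /signed_weight odd_flip // signrN mulNr; congr (- (_ * _)).
transitivity (\prod_k word_weight b c (S k) (swap S (word_of p.2) k)).
  by apply: eq_bigr => k _; rewrite -(word_of_flip pc).
exact: swap_weight.
Qed.

(* Flipping exchanges the odd and the even permutations, so the two halves of the
   sum cancel even when 2 is a zero divisor in [R]. *)
Lemma sum_crossing_systems : \sum_(p | crossing_system p) signed_weight p = 0.
Proof.
rewrite (bigID (fun p : 'S_n * words => odd_perm p.1)) /=.
rewrite (reindex_onto flip flip) /=; last by move=> p /andP[/flipK].
rewrite [X in X + _](eq_bigl
  (fun p => crossing_system p && ~~ odd_perm p.1)) => [|p].
  rewrite -big_split big1 // => p /andP[pc _] /=.
  by rewrite signed_weight_flip // addNr.
apply/idP/idP => [/andP[/andP[pc op] /eqP pK]|/andP[pc op]].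
  move/crossing_system_flip: (pc); rewrite pK => -> /=.
  by rewrite -{1}pK odd_flip // op.
rewrite crossing_system_flip //= -[odd_perm _]/(odd_perm (flip p).1).
by rewrite odd_flip // op flipK /=.
Qed.

(** Expanding the determinant and distributing the products yields all connected systems, of which
    the crossing ones cancel. Several permutations may connect the same words when [T] repeats a
    point, hence the inner sum. *)
Lemma lgv : \det (\matrix_(i, j) \sum_(w : B.-bseq (step l) |
     lands_at (T j) ((S i, w : seq _))) word_weight b c (S i) w) =
  \sum_(ws : words | ~~ crossing S (word_of ws))
     \sum_(s | connected S T s (word_of ws)) signed_weight (s, ws).
Proof.
rewrite /determinant.
transitivity (\sum_s \sum_(ws : words | connected S T s (word_of ws))
   signed_weight (s, ws)).
  apply: eq_bigr => s _; under eq_bigr do rewrite mxE.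
  rewrite bigA_distr_big_dep mulr_sumr; apply: eq_bigl => ws.
  by apply/familyP/forallP.
rewrite pair_big_dep /=.
rewrite (bigID (fun p : 'S_n * words => crossing S (word_of p.2))) /=.
rewrite (eq_bigr signed_weight) => [|[]//]; rewrite sum_crossing_systems add0r.
rewrite [RHS]pair_big_dep /= (reindex (fun p : words * 'S_n => (p.2, p.1))) /=.
  by apply: eq_bigl => p; rewrite andbC.
by exists (fun p => (p.2, p.1)) => -[].
Qed.

End LGV.

(** * Path sums and path systems *)

Lemma big_option (V : nmodType) (I : finType) (F : option I -> V) :
  \sum_s F s = F None + \sum_i F (Some i).
Proof.
rewrite (bigD1 None) //=; congr (_ + _).
by rewrite (reindex_omap Some id) => [|[]] //=; apply: eq_bigl => i; rewrite eqxx.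
Qed.

Lemma big_bseqS (V : nmodType) (X : finType) (x0 : X) B (F : seq X -> V) :
  \sum_(w : B.+1.-bseq X) F w = F [::] + \sum_x \sum_(w : B.-bseq X) F (x :: w).
Proof.
rewrite (bigD1 [bseq]) //=; congr (_ + _); rewrite pair_big /=.
rewrite (reindex_onto (fun p : X * B.-bseq X => [bseq of p.1 :: p.2])
   (fun w => (head x0 w, [bseq of behead w]))) /=.
  by apply: eq_bigl => -[x w] /=; apply/eqP; congr (_, _); apply: val_inj.
by move=> [[|x w] ?] //= _; apply: val_inj.
Qed.

Section PathSum.
Variables (R : comNzRingType) (l : nat).
Variables (b : 'I_l.+1 -> int -> R) (c : int -> R).
Hypothesis l_gt0 : (0 < l)%N.
Implicit Types (P Q : Defs.point) (a : int).

Definition path_sum B Q P : R :=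
  \sum_(w : B.-bseq (step l))
    if lands_at Q ((P, w : seq _) : lpath l) then word_weight b c P w else 0.

Lemma lands_at_nil Q P :
  lands_at Q ((P, [::]) : lpath l) = (P == Q) && (0 <= P.2).
Proof. by rewrite /lands_at /= andbT. Qed.

Lemma lands_at_cons Q P s w :
  lands_at Q ((P, s :: w) : lpath l) =
  (0 <= P.2) && lands_at Q ((P + step_vec s, w) : lpath l).
Proof. by rewrite /lands_at path_final_cons -!/(verts _ _) verts_cons /= andbCA. Qed.

Lemma path_sum_below B Q P : P.2 < 0 -> path_sum B Q P = 0.
Proof.
rewrite ltNge => /negbTE P0; rewrite /path_sum big1 // => w _.
by case: (val w) => [|s u]; rewrite ?lands_at_nil ?lands_at_cons P0 ?andbF.
Qed.

Lemma final_level P w :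
  P.1 + P.2 <= (path_final ((P, w) : lpath l)).1 + (path_final ((P, w) : lpath l)).2.
Proof.
elim: w P => [|s w IH] P //; rewrite path_final_cons; apply: le_trans (IH _).
by case: s => [i|] /=; lia.
Qed.

Lemma path_sum_above B Q P : Q.1 + Q.2 < P.1 + P.2 -> path_sum B Q P = 0.
Proof.
move=> QP; rewrite /path_sum big1 // => w _; case: ifP => // /andP[/eqP E _].
by have := final_level P w; rewrite E leNgt QP.
Qed.

Lemma path_sumS B Q P : 0 <= P.2 ->
  path_sum B.+1 Q P = (P == Q)%:R
  + c ((P.1 + P.2) %/ l%:Z)%Z * path_sum B Q (P + (1, -1))
  + \sum_(i < l.+1)
      b i ((P.1 + P.2) %/ l%:Z)%Z * path_sum B Q (P + (i%:Z, l%:Z - i%:Z)).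
Proof.
move=> P0; rewrite /path_sum
  (big_bseqS None _
    (fun w => if lands_at Q (P, w) then word_weight b c P w else 0)).
rewrite lands_at_nil P0 andbT big_option addrA; congr (_ + _ + _).
- by case: ifP.
- rewrite mulr_sumr; apply: eq_bigr => w _; rewrite lands_at_cons P0 /=.
  by case: ifP => // _; rewrite mulr0.
apply: eq_bigr => i _; rewrite mulr_sumr; apply: eq_bigr => w _.
by rewrite lands_at_cons P0 /=; case: ifP => // _; rewrite mulr0.
Qed.

Lemma land0 a y : land b c a 0 'X^y = c a ^+ y.
Proof. by rewrite /land /= hornerXn addr0. Qed.

Lemma land_up a m y : land b c (a + 1) m (up b a * 'X^y) =
  \sum_(i < l.+1) b i a * land b c (a + 1) m 'X^(y + (l - i)).
Proof.
rewrite mulr_suml land_sum; apply: eq_bigr => i _.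
by rewrite -scalerAl landZ -exprD addnC.
Qed.

(** This mirrors the first-step recurrence [path_sumS] on the polynomial side, so that the two sums
    can be compared by induction. *)
Lemma land_run a m y : land b c a m.+1 'X^y =
  (if y is y'.+1 then c a * land b c a m.+1 'X^y' else 0) +
  \sum_(i < l.+1) b i a * land b c (a + 1) m 'X^(y + (l - i)).
Proof.
rewrite -land_up landS /push1; case: y => [|y]; first by rewrite down1 add0r.
by rewrite downXS mulrDr landD addrC landS -scalerAr landZ.
Qed.

(* [2 * l * m + y] bounds the length of the paths that are summed. *)
Lemma path_sum_land B a m y : (2 * l * m + y <= B)%N ->
  path_sum B (l%:Z * (a + m%:Z), 0) (l%:Z * a - y%:Z, y%:Z) = land b c a m 'X^y.
Proof.
elim: B a m y => [|B IH] a m y szB.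
  have [-> ->] : m = 0%N /\ y = 0%N by nia.
  rewrite land0 /path_sum (big_pred1 [bseq]); last first.
    by move=> w; apply/esym/eqP/val_inj; case: w => [[]].
  by rewrite lands_at_nil addr0 subr0 eqxx.
rewrite path_sumS //= subrK mulKz; last by lia.
(* A down step from height 0 leaves the half plane and contributes 0. *)
have downE' : path_sum B (l%:Z * (a + m%:Z), 0) ((l%:Z * a - y%:Z, y%:Z) + (1, -1))
   = if y is y'.+1 then land b c a m 'X^y' else 0.
  case: y szB => [|y] szB; first by rewrite path_sum_below.
  rewrite -IH; last by lia.
  by congr (path_sum _ _ (_, _)); rewrite /=; lia.
rewrite {}downE'; case: m => [|m] in szB *.
  (* On the last level every crossing step overshoots the level of the target. *)
  rewrite [X in _ + X]big1 => [|i _]; last first.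
    by rewrite path_sum_above ?mulr0 //=; lia.
  rewrite addr0 land0 addr0 -pair_eqE /pair_eq /=.
  case: y {szB IH} => [|y]; first by rewrite subr0 !eqxx mulr0 addr0 expr0.
  by rewrite andbF add0r land0 exprS.
rewrite land_run -pair_eqE /pair_eq /= [_ && _](_ : _ = false) ?add0r; last first.
  by apply/negbTE/negP => /andP[/eqP E1 /eqP E2]; nia.
congr (_ + _); first by case: y {szB IH} => [|y] //; rewrite mulr0.
(* A crossing lowers the length bound by [l + i], which is positive. *)
apply: eq_bigr => i _; rewrite -IH; last by nia.
have il := ltn_ord i.
by congr (_ * path_sum _ (_, _) (_, _)); rewrite /=; nia.
Qed.

End PathSum.

(** * The systems in [Pi l n] as systems of bounded words *)

Section Systems.
Variables (R : comNzRingType) (l n : nat).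
Variables (b : 'I_l.+1 -> int -> R) (c : int -> R).
Hypothesis l_gt0 : (0 < l)%N.
Let S := @start_pt l n.
Let T := @end_pt l n.
Let B := (2 * (n * l) + 2 * n)%N.
Local Notation words := {ffun 'I_n -> B.-bseq (step l)}.

Definition system_of (ws : words) : {ffun 'I_n -> lpath l} :=
  [ffun i => (S i, ws i : seq _)].

Lemma system_of_inj : injective system_of.
Proof.
move=> ws ws' E; apply/ffunP => i; apply: val_inj.
by have := congr1 (fun f : {ffun _ -> lpath l} => (f i).2) E; rewrite !ffunE.
Qed.

Lemma length_bound (i j : 'I_n) :
  2 * (T j).1 + (T j).2 - (2 * (S i).1 + (S i).2) <= B%:Z.
Proof.
rewrite /T /S /start_pt /end_pt /B /=.
by have := ltn_ord i; have := ltn_ord j => *; nia.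
Qed.

Lemma connected_system_of (ws : words) s :
  connected S T s (word_of ws) <->
  connects S T (system_of ws) s /\ forall i, schroder (system_of ws i).
Proof.
split=> [/forallP ok|[con sch]].
  split=> i; have /andP[/eqP fi /allP ai] := ok i; rewrite ?/schroder ffunE //.
apply/forallP => i; apply/andP; split.
  by have [_ fi] := con i; rewrite ffunE in fi; apply/eqP.
by apply/allP => V Vi; apply: (sch i); rewrite ffunE.
Qed.

Lemma nonintersecting_system_of (ws : words) :
  nonintersecting (system_of ws) <-> ~~ crossing S (word_of ws).
Proof.
split=> [ni|nc i j ij V].
  apply/negP => /card_gt1P[i [j [Vi Vj ij]]].
  have := ni _ _ ij (crossing_pt S (word_of ws)); rewrite !ffunE.
  by move=> /(_ Vi)/negP; apply.
rewrite !ffunE => Vi; apply: contra nc => Vj; apply: (@crossingP _ _ _ _ V).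
by apply/card_gt1P; exists i, j; split.
Qed.

(** By [length_bound] the words of all these paths have length at most [B], so the sum over [Pi l n]
    becomes one over a finite type. *)
Lemma Pi_image : Pi l n = (system_of @` (fun ws => ~~ crossing S (word_of ws) /\
  exists s, connected S T s (word_of ws)))%classic.
Proof.
apply/seteqP; split=> [w [[s con] sch ni]|_ [ws [nc [s con]] <-]]; last first.
  have /connected_system_of[con' sch] := con.
  by split=> //; [exists s|apply/nonintersecting_system_of].
pose ws : words := [ffun i => insub_bseq B (w i).2].
have wE : system_of ws = w.
  apply/ffunP => i; rewrite !ffunE /insub_bseq insubdK.
    by have [st _] := con i; rewrite /S -st; case: (w i).
  have [st fin] := con i; have := size_path_le (w i) l_gt0.
  by rewrite fin st => /le_trans/(_ (length_bound i (s i))).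
exists ws => //; split.
  by apply/nonintersecting_system_of; rewrite wE.
by exists s; apply/connected_system_of; rewrite wE.
Qed.

(** The ends are distinct, so at most one permutation connects a system, and the inner sum of [lgv]
    reduces to the term found by [pick], if any. *)
Lemma system_weight_of (ws : words) :
  (\sum_(s | connected S T s (word_of ws)) signed_weight b c S (s, ws)) =
  if `[< exists s, connected S T s (word_of ws) >]
  then system_weight b c S T (system_of ws) else 0.
Proof.
case: asboolP => [[s con]|ncon]; last first.
  by rewrite big1 // => s con; case: ncon; exists s.
have [cons sch] := (connected_system_of ws s).1 con.
rewrite (big_pred1 s) => [|t]; last first.
  apply/idP/eqP => [/connected_system_of[cont _]|-> //].
  exact: (connects_inj (end_pt_inj l_gt0) cont cons).
rewrite /system_weight; case: pickP => [t /asboolP cont|/(_ s)/asboolP[]//].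
rewrite (connects_inj (end_pt_inj l_gt0) cont cons) /signed_weight.
by congr (_ * _); apply: eq_bigr => i _; rewrite ffunE.
Qed.

Lemma v_Pi_det : v_Pi n b c = \det (land_mx b c n).
Proof.
transitivity (\det (\matrix_(i, j) \sum_(w : B.-bseq (step l) |
     lands_at (T j) ((S i, w : seq _))) word_weight b c (S i) w)).
  rewrite (lgv _ _ l_gt0 length_bound) /v_Pi Pi_image fsbig_image; last first.
    by move=> ws ws' _ _; apply: system_of_inj.
  rewrite fsbig_mkcond (@fsbigE _ _ _ _ _ (index_enum _)) ?index_enum_uniq //;
    last first.
    by move=> ws _; rewrite mem_index_enum.
  rewrite [RHS]big_mkcond; apply: eq_big => [ws|ws _]; first by rewrite in_setT.
  rewrite system_weight_of /patch; case: ifPn => [/set_mem[-> con]|].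
    by rewrite asboolT.
  case: (boolP (crossing S (word_of ws))) => //= nc nin.
  by case: asboolP => // con; case/negP: nin; apply/mem_set.
congr (\det _); apply/matrixP => i j; rewrite !mxE big_mkcond.
have := @path_sum_land R l b c l_gt0 B (- (i %/ l)%N%:Z) (i %/ l + j.+1) (i %% l).
have i_eq := divn_eq i l.
(* Euclidean division of [i] by [l] brings both endpoints into the form of [path_sum_land]. *)
have -> : S i = (l%:Z * - (i %/ l)%N%:Z - (i %% l)%N%:Z, (i %% l)%N%:Z).
  by congr (_, _); lia.
have -> : T j = (l%:Z * (- (i %/ l)%N%:Z + (i %/ l + j.+1)%N%:Z), 0).
  by congr (_, _); lia.
by apply; rewrite /B; have := ltn_ord i; have := ltn_ord j => *; nia.
Qed.

End Systems.

Theorem theorem4p10 (R : comNzRingType) (l : nat) (l_gt0 : (0 < l)%N)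
    (b : 'I_l.+1 -> int -> R) (c : int -> R) (n : nat) :
  v_Pi n b c =
    (\prod_(2 <= i < n.+1)
       (c i%:Z ^+ (i - 1) * \prod_(1 <= j < ((i - 1) %/ l).+1) b ord0 (- j%:Z)))
    * (\prod_(1 <= s < n.+1) \prod_(0 <= t < s)
         \sum_(i < l.+1) b i t%:Z * c s%:Z ^+ (l - i)).
Proof.
rewrite v_Pi_det // det_land_mx.
(* The factor for [i = 1] equals 1, so the product may start there and match the matrix indices
   through [i = k.+1]. *)
have shift (F : nat -> R) : F 1%N = 1 ->
    \prod_(2 <= i < n.+1) F i = \prod_(k < n) F k.+1.
  move=> F1; transitivity (\prod_(1 <= k < n.+1) F k).
    case: n => [|m]; first by rewrite !big_geq.
    by rewrite [RHS]big_ltn // F1 mul1r.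
  by rewrite big_add1 big_mkord.
rewrite shift; last by rewrite subnn div0n [X in _ * X]big_geq // mulr1.
rewrite big_add1 big_mkord -!big_split; apply: eq_bigr => k _ /=.
rewrite land_newton_diag mulrA subn1 [_.+1.-1]/= [X in X * _]mulrC.
congr (_ * _ * _); last by rewrite big_mkord.
(* Reversing the order matches the levels [- (k %/ l) + t] with [- (t + 1)]. *)
rewrite big_add1 big_mkord (reindex_inj rev_ord_inj); apply: eq_bigr => t _.
by congr (b _ _) => /=; have := ltn_ord t; lia.
Qed.
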